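(* Let $p$ be a prime number and let $1\to A\hookrightarrow B\xrightarrow{\lambda} C\to 1$ be a split exact sequence of groups with section $\sigma:C\to B$ (a homomorphism with $\lambda\circ\sigma=\mathrm{Id}_C$), such that $B$ is a $p$-almost direct product of $A$ and $C$. Then for all $n\geq 1$ there is a split exact sequence $$1\to \gamma_n^pA\hookrightarrow \gamma_n^pB\xrightarrow{\lambda_n}\gamma_n^pC\to 1$$ with section $\sigma_n:\gamma_n^pC\to\gamma_n^pB$, where $\lambda_n$ and $\sigma_n$ are the restrictions of $\lambda$ and $\sigma$.
   Context: Commutators are $[h,k]=h^{-1}k^{-1}hk$, and for subgroups $H,K$ of a group $G$, $[H,K]$ is the subgroup generated by all $[h,k]$ with $h\in H$, $k\in K$; $H^p$ denotes the subgroup generated by $\{h^p : h\in H\}$. The lower $\mathbb{F}_p$-linear central filtration $(\gamma_n^pG)_{n\ge1}$ of $G$ is defined by $\gamma_1^pG=G$ and $\gamma_{n+1}^pG$ is the subgroup of $G$ generated by $[G,\gamma_n^pG]\cup(\gamma_n^pG)^p$. In particular $G/\gamma_2^pG=H_1(G;\mathbb{F}_p)$. Given a split exact sequence $1\to A\to B\to C\to 1$ with section $\sigma$, $B$ is called a $p$-almost direct product of $A$ and $C$ if the action of $C$ (by conjugation by elements $\sigma(c)$) induced on $H_1(A;\mathbb{F}_p)=A/\gamma_2^pA$ is trivial. *)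

(* Defs.v *)
From HB Require Import structures.
From mathcomp Require Import all_boot.
From mathcomp Require Import boolp classical_sets functions.

Set Implicit Arguments.
Unset Strict Implicit.
Unset Printing Implicit Defensive.

Local Open Scope classical_set_scope.
Local Open Scope group_scope.

(* Groups are [groupType]s, which may be infinite; subgroups are classical sets
   satisfying [group_closed]. *)

Definition generated (G : groupType) (S : set G) : set G :=
  smallest [set H : set G | group_closed (mem H)] S.

Definition commutator_subgroup (G : groupType) (H K : set G) : set G :=
  generated [set [~ h, k] | h in H & k in K].

Definition power_subgroup (G : groupType) (p : nat) (H : set G) : set G :=
  generated [set h ^+ p | h in H].

(* The filtration is indexed from 1; the value at 0 is a dummy. *)
Fixpoint lower_central (p : nat) (G : groupType) (n : nat) : set G :=
  match n with
  | 0 | 1 => setT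
  | m.+1 => generated (commutator_subgroup setT (lower_central p m)
                       `|` power_subgroup p (lower_central p m))
  end.
Arguments lower_central p G n : clear implicits.

Definition left_coset (G : groupType) (N : set G) (x : G) : set G :=
  [set x * y | y in N].

(* The elements of H_1(G; F_p) are the cosets making up G / gamma_2^p G. *)
Definition H1 (p : nat) (G : groupType) : set (set G) :=
  range (left_coset (lower_central p G 2)).
Arguments H1 p G : clear implicits.

(* [iota] identifies A with the kernel of B -> C, which is normal in B, so the
   preimage below is X conjugated by sigma(c) inside A. On X in [H1 p A] this
   is the induced action of C on H_1(A; F_p). *)
Definition conj_action (A B C : groupType) (iota : UMagmaMorphism.type A B)
    (sigma : UMagmaMorphism.type C B) (c : C) (X : set A) : set A :=
  iota @^-1` [set iota x ^ sigma c | x in X].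

Definition p_almost_direct (p : nat) (A B C : groupType)
    (iota : UMagmaMorphism.type A B) (sigma : UMagmaMorphism.type C B) : Prop :=
  forall (c : C) (X : set A), H1 p A X -> conj_action iota sigma c X = X.

(* The restrictions of [iota], [lambda], [sigma] to A', B', C' form a split
   exact sequence of groups 1 -> A' -> B' -> C' -> 1. *)
Record split_exact (A B C : groupType)
    (iota : UMagmaMorphism.type A B) (lambda : UMagmaMorphism.type B C)
    (sigma : UMagmaMorphism.type C B)
    (A' : set A) (B' : set B) (C' : set C) : Prop := SplitExact {
  subgroup_left : group_closed (mem A');
  subgroup_middle : group_closed (mem B');
  subgroup_right : group_closed (mem C');
  iota_restricts : set_fun A' B' iota;
  lambda_restricts : set_fun B' C' lambda;
  sigma_restricts : set_fun C' B' sigma;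
  iota_injective : set_inj A' iota;
  exact_middle : iota @` A' = B' `&` lambda @^-1` [set 1];
  lambda_surjective : set_surj B' C' lambda;
  lambda_sigma : {in C', cancel sigma lambda}
}.

(* Main.v *)
Require Import Defs.
From HB Require Import structures.
From mathcomp Require Import all_boot.
From mathcomp Require Import boolp classical_sets functions.

(** Everything follows from two facts about a descending filtration (N_k) of a
group G by normal subgroups with [N_k, G] and N_k^p inside N_(k+1).

- [comm_lower_central]: [N_m, gamma_n G] lies in N_(m+n). The case n = 1 is the
  hypothesis on N; a commutator is handled by a three subgroups argument, a
  p-th power by the congruence of [x, h^p] and [x, h]^p modulo N_(m+n+1), for x in
  N_m and h in gamma_n G.
- [endo_lower_central]: an endomorphism f of G that is the identity modulo N_0
  moves the elements of gamma_(m+1) G only by elements of N_m, because by the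
  first fact these corrections disappear from commutators and p-th powers at the
  next level.

Both are used twice. On A, take N_k = gamma_(k+2) A and let f be conjugation by
sigma(c): the p-almost direct product hypothesis says exactly that f is the
identity modulo gamma_2 A, so [gamma_n A, sigma(C)] lies in gamma_(n+1) A
([comm_conj_lower_central]). Since iota(A) and sigma(C) generate B, it follows
that N_k = iota(gamma_(k+1) A) satisfies the hypotheses of the two facts in B
([image_filtration]). Now let f be sigma o lambda, which is the identity modulo
iota(A) = N_0. Then b = sigma(lambda(b)) modulo iota(gamma_n A) for every b in
gamma_n B, and an element of gamma_n B killed by lambda is in
iota(gamma_n A). The remaining parts of the conclusion hold because gamma_n is
functorial.

Computations modulo a normal subgroup are carried out in an actual quotient
group, where congruences become equations. *)

(** * Subgroups and quotients *)

Section Subgroups.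
Set Implicit Arguments.
Unset Strict Implicit.
Local Open Scope classical_set_scope.
Local Open Scope group_scope.

Lemma group_closed_set (G : groupType) (H : set G) :
  group_closed (mem H) <-> H 1 /\ forall x y, H x -> H y -> H (x / y).
Proof.
split=> -[H1 HF]; split.
- exact: set_mem H1.
- by move=> x y Hx Hy; apply: set_mem; apply: HF; apply: mem_set.
- exact: mem_set.
- by move=> x y Hx Hy; apply: mem_set; apply: HF; apply: set_mem.
Qed.

Section Closure.
Variables (G : groupType) (H : set G).
Hypothesis clH : group_closed (mem H).

Lemma set_closed1 : H 1.
Proof. by case/group_closed_set: clH. Qed.

Lemma set_closedF x y : H x -> H y -> H (x / y).
Proof. by case/group_closed_set: clH => _; apply. Qed.

Lemma set_closedV x : H x -> H x^-1.
Proof. by move=> Hx; rewrite -div1g; apply: set_closedF set_closed1 _. Qed.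

Lemma set_closedM x y : H x -> H y -> H (x * y).
Proof. by move=> Hx Hy; rewrite -[y]invgK; apply/set_closedF/set_closedV. Qed.

End Closure.

(** Turns congruences modulo a normal subgroup N into equations between values of
pi, where the usual group identities apply. *)
Lemma quotient_exists (G : groupType) (N : set G) :
    group_closed (mem N) -> (forall x g, N x -> N (x ^ g)) ->
  exists (Q : groupType) (pi : UMagmaMorphism.type G Q),
    forall x, N x <-> pi x = 1.
Proof.
move=> clN nN.
pose cong : rel G := fun x y => `[< N (x^-1 * y) >].
have cong_equiv : equiv_class_of cong.
  split.
  - by move=> x; apply/asboolP; rewrite mulVg; apply: set_closed1.
  - move=> x y; apply/asboolP/asboolP => /(set_closedV clN);
      by rewrite invgM invgK.
  - move=> y x z /asboolP Nxy /asboolP Nyz; apply/asboolP.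
    by have := set_closedM clN Nxy Nyz; rewrite -mulgA mulVKg.
pose congE := EquivRelPack cong_equiv.
pose Qt := {eq_quot congE}%qT.
pose p (x : G) : Qt := \pi_Qt%qT x.
have pE x y : p x = p y <-> N (x^-1 * y).
  split; first by move/eqquotP/asboolP.
  by move=> Nxy; apply/eqquotP/asboolP.
pose r (u : Qt) : G := repr u.
have rK u : p (r u) = u by exact: reprK.
have pr x : N ((r (p x))^-1 * x) by apply/pE; rewrite rK.
pose mulQ (u v : Qt) := p (r u * r v).
pose invQ (u : Qt) := p (r u)^-1.
(* The operations on classes do not depend on representatives; this is where N
     has to be normal. *)
have mulp x y : mulQ (p x) (p y) = p (x * y).
  apply/pE; rewrite invgM.
  have -> : (r (p y))^-1 * (r (p x))^-1 * (x * y)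
            = ((r (p x))^-1 * x) ^ r (p y) * ((r (p y))^-1 * y).
    by rewrite conjgE !mulgA mulgK.
  by apply: set_closedM => //; apply: nN.
have invp x : invQ (p x) = p x^-1.
  apply/pE; rewrite invgK.
  have -> : r (p x) / x = (((r (p x))^-1 * x)^-1) ^ (r (p x))^-1.
    by rewrite conjgE invgM !invgK mulgK.
  by apply: nN; apply: set_closedV.
have mulQA : associative mulQ.
  by move=> u v w; rewrite -[u]rK -[v]rK -[w]rK !mulp mulgA.
have mul1Q : left_id (p 1) mulQ.
  by move=> u; rewrite -[u]rK mulp mul1g.
have mulQ1 : right_id (p 1) mulQ.
  by move=> u; rewrite -[u]rK mulp mulg1.
have mulVQ : left_inverse (p 1) invQ mulQ.
  by move=> u; rewrite -[u]rK invp mulp mulVg.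
have mulQV : right_inverse (p 1) invQ mulQ.
  by move=> u; rewrite -[u]rK invp mulp mulgV.
pose Q : groupType := HB.pack Qt (isGroup.Build Qt mulQA mul1Q mulQ1 mulVQ mulQV).
pose pQ : G -> Q := p.
have pF : {morph pQ : x y / x / y}.
  by move=> x y; rewrite /pQ -mulp -invp.
pose pi : UMagmaMorphism.type G Q :=
  HB.pack pQ (isGroupMorphism.Build G Q pQ pF).
exists Q, pi => x; split=> [Nx | px].
  by apply/esym/pE; rewrite invg1 mul1g.
by have /pE := esym px : p 1 = p x; rewrite invg1 mul1g.
Qed.

Lemma generated_sub (G : groupType) (S : set G) : S `<=` generated S.
Proof. exact: sub_gen_smallest. Qed.

Lemma generated_closed (G : groupType) (S : set G) :
  group_closed (mem (generated S)).
Proof.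
apply/group_closed_set; split=> [H [clH _] | x y Sx Sy H [clH SH]].
  exact: set_closed1.
by apply: set_closedF; [| apply: Sx | apply: Sy].
Qed.

End Subgroups.

(** * Commutators of elements with commuting corrections *)

Section Commutators.
Set Implicit Arguments.
Unset Strict Implicit.
Local Open Scope group_scope.

Lemma commgX_commute (Q : groupType) (x h : Q) k :
  commute [~ x, h] h -> [~ x, h ^+ k] = [~ x, h] ^+ k.
Proof.
move=> ch; elim: k => [|k IHk]; first by rewrite commg1.
have xh : x ^ h = x * [~ x, h] by rewrite commgEl mulVKg.
apply: (mulgI x); rewrite commgEl mulVKg expgS conjgM xh conjMg.
have -> : [~ x, h] ^ (h ^+ k) = [~ x, h].
  by apply/conjg_fixP/commgP/commuteX.
have -> : x ^ (h ^+ k) = x * [~ x, h] ^+ k by rewrite -IHk commgEl mulVKg.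
by rewrite -mulgA -expgSr expgS.
Qed.

(** Conjugations by g and h agree in either order on y as soon as they do not
interfere: each fixes the factor by which the other moves y. *)
Lemma conjg_mulC (Q : groupType) (y g h : Q) :
    commute [~ y, g] h -> commute [~ y, h] g -> commute [~ y, g] [~ y, h] ->
  y ^ (g * h) = y ^ (h * g).
Proof.
move=> /commgP/conjg_fixP uh /commgP/conjg_fixP vg uv.
have yE z : y ^ z = y * [~ y, z] by rewrite commgEl mulVKg.
by rewrite !conjgM !yE !(conjMg y) uh vg !yE -!(mulgA y) uv.
Qed.

Lemma commg_mulr (Q : groupType) (g h u v : Q) :
    commute v g -> commute v u -> commute v h ->
    commute u h -> commute u [~ g, h] ->
  [~ g * u, h * v] = [~ g, h].
Proof.
move=> vg vu vh /commgP/conjg_fixP uh ugh.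
have vguh : commute v ((g * u) ^ h).
  by apply/commuteM/commuteM => //; [apply: commuteV | apply: commuteM].
have guh : (g * u) ^ h = g * ([~ g, h] * u).
  by rewrite conjMg uh [in RHS]commgEl -(mulgA g^-1) mulVKg.
rewrite commgEl conjgM.
have -> : ((g * u) ^ h) ^ v = (g * u) ^ h.
  exact/conjg_fixP/commgP/commute_sym.
by rewrite guh -ugh (mulgA g) mulKg.
Qed.

End Commutators.

(** * The lower F_p-linear central filtration *)

Section LowerCentral.
Set Implicit Arguments.
Unset Strict Implicit.
Local Open Scope classical_set_scope.
Local Open Scope group_scope.
Variable p : nat.

Lemma lower_central_closed (G : groupType) n :
  group_closed (mem (lower_central p G n)).
Proof.
by case: n => [|[|n]]; [split; rewrite ?inE // => ? ?; rewrite !inE ..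
                       | apply: generated_closed].
Qed.

Lemma lower_central_comm (G : groupType) n (g h : G) :
  lower_central p G n.+1 h -> lower_central p G n.+2 [~ g, h].
Proof.
move=> Gh; apply: generated_sub; left.
by apply: generated_sub; exists g => //; exists h.
Qed.

Lemma lower_central_pow (G : groupType) n (h : G) :
  lower_central p G n.+1 h -> lower_central p G n.+2 (h ^+ p).
Proof.
by move=> Gh; apply: generated_sub; right; apply: generated_sub; exists h.
Qed.

(** Induction principle: the nested generated subgroups of the definition are
flattened into a single generating set. *)
Lemma lower_central_sub (G : groupType) n (S : set G) :
    group_closed (mem S) ->
    (forall g h, lower_central p G n.+1 h -> S [~ g, h]) ->
    (forall h, lower_central p G n.+1 h -> S (h ^+ p)) ->
  lower_central p G n.+2 `<=` S.
Proof.
move=> clS commS powS; apply: smallest_sub => // x [] Hx; apply: Hx;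
  split=> // y.
- by case=> g _ [h Gh <-]; apply: commS.
- by case=> h Gh <-; apply: powS.
Qed.

Lemma lower_central_desc (G : groupType) n :
  lower_central p G n.+2 `<=` lower_central p G n.+1.
Proof.
elim: n => [//|n IHn].
apply: lower_central_sub; first exact: lower_central_closed.
- by move=> g h /IHn; apply: lower_central_comm.
- by move=> h /IHn; apply: lower_central_pow.
Qed.

Lemma lower_central_morph (G H : groupType) (f : UMagmaMorphism.type G H) n x :
  lower_central p G n.+1 x -> lower_central p H n.+1 (f x).
Proof.
elim: n x => [//|n IHn].
apply: (@lower_central_sub G n (f @^-1` lower_central p H n.+2)).
- have clH := @lower_central_closed H n.+2.
  apply/group_closed_set; split=> [|x y] /=.
    by rewrite gmulf1; apply: set_closed1.
  by rewrite gmulfF; apply: set_closedF.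
- by move=> g h /IHn; rewrite /= gmulfR; apply: lower_central_comm.
- by move=> h /IHn; rewrite /= gmulfXn; apply: lower_central_pow.
Qed.

(** * Central filtrations with quotients of exponent p *)

(** The filtration need not start at G: the proof applies the theory of this part
to gamma_(k+2) A in A and to iota(gamma_(k+1) A) in B as well. *)
Record central_filtration (G : groupType) (N : nat -> set G) : Prop :=
  CentralFiltration {
    cf_closed k : group_closed (mem (N k));
    cf_desc k : N k.+1 `<=` N k;
    cf_comm k x g : N k x -> N k.+1 [~ x, g];
    cf_pow k x : N k x -> N k.+1 (x ^+ p)
  }.

Lemma lower_central_filtration (G : groupType) :
  central_filtration (fun k => lower_central p G k.+1).
Proof.
split=> [k|k|k x g Gx|k x].
- exact: lower_central_closed.
- exact: lower_central_desc.
- rewrite -invgR; apply: (set_closedV (lower_central_closed _ _)).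
  exact: lower_central_comm.
- exact: lower_central_pow.
Qed.

Lemma central_filtration_shift (G : groupType) (N : nat -> set G) :
  central_filtration N -> central_filtration (fun k => N k.+1).
Proof.
by case=> clN descN commN powN; split=> *; [apply: clN | apply: descN
                                           | apply: commN | apply: powN].
Qed.

Section Filtration.
Variables (G : groupType) (N : nat -> set G).
Hypothesis cfN : central_filtration N.

Lemma cf_normal k x g : N k x -> N k (x ^ g).
Proof.
move=> Nx; have -> : x ^ g = x * [~ x, g] by rewrite commgEl mulVKg.
apply: (set_closedM (cf_closed cfN k) Nx).
exact/(cf_desc cfN)/(cf_comm cfN).
Qed.

Lemma cf_quotient k :
  exists (Q : groupType) (pi : UMagmaMorphism.type G Q),
    forall x, N k x <-> pi x = 1.
Proof. by apply: quotient_exists => [|x g]; [case: cfN | apply: cf_normal]. Qed.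

Lemma quotient_commute (Q : groupType) (pi : UMagmaMorphism.type G Q) k x g :
    (forall x, N k x <-> pi x = 1) ->
  N k [~ x, g] <-> commute (pi x) (pi g).
Proof.
move=> piN; rewrite piN gmulfR.
by split=> [/eqP/commgP | /commgP/eqP].
Qed.

(** The elements g with [N_m, g] inside N_(m+n+1) for all m form a subgroup;
it contains gamma_(n+1) because, writing S_n for it, [S_0, S_n] and S_n^p lie
in S_(n+1). *)
Lemma comm_lower_central m n x g :
  N m x -> lower_central p G n.+1 g -> N (m + n).+1 [~ x, g].
Proof.
elim: n m x g => [|n IHn] m x g.
  by rewrite addn0 => Nx _; apply: cf_comm.
pose S := [set g | forall m x, N m x -> N (m + n.+1).+1 [~ x, g]].
move=> Nx Gg; suff /(_ g Gg) : lower_central p G n.+2 `<=` S by apply.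
move=> {m x g Nx Gg}; apply: lower_central_sub.
- apply/group_closed_set; split=> [m x Nx | g h Sg Sh m x Nx].
    by rewrite commg1; apply: (set_closed1 (cf_closed cfN _)).
  have [Q [pi piN]] := cf_quotient (m + n.+1).+1.
  apply/(quotient_commute _ _ piN); rewrite gmulfM gmulfV.
  by apply: commuteM; [| apply: commuteV];
    apply/(quotient_commute _ _ piN); [apply: Sg | apply: Sh].
- move=> g h Gh m x Nx.
  have [Q [pi piN]] := cf_quotient (m + n.+1).+1.
  have swap y : N m y -> pi y ^ (pi g * pi h) = pi y ^ (pi h * pi g).
    move=> Ny; have Nu : N m.+1 [~ y, g] by apply: cf_comm.
    have Nv : N (m + n).+1 [~ y, h] by apply: IHn.
    apply: conjg_mulC; rewrite -!gmulfR; apply/(quotient_commute _ _ piN).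
    + by rewrite addnS -addSn; apply: IHn.
    + by rewrite addnS; apply: cf_comm.
    + by rewrite -invgR; apply: (set_closedV (cf_closed cfN _));
        rewrite addnS; apply: cf_comm.
  apply/(quotient_commute _ _ piN)/commgP/conjg_fixP.
  rewrite gmulfR.
  (* [~ g, h] is (h g)^-1 (g h): apply swap to x conjugated by (h g)^-1. *)
  have -> : [~ pi g, pi h] = (pi h * pi g)^-1 * (pi g * pi h).
    by rewrite invgM -mulgA.
  have := swap _ (cf_normal (h * g)^-1 Nx); rewrite gmulfJ gmulfV gmulfM.
  by rewrite (conjgM (pi x)) => ->; rewrite conjgKV.
- move=> h Gh m x Nx.
  have [Q [pi piN]] := cf_quotient (m + n.+1).+1.
  have Nv : N (m + n).+1 [~ x, h] by apply: IHn.
  apply/piN; rewrite gmulfR gmulfXn commgX_commute -gmulfR.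
    by rewrite -gmulfXn; apply/piN; rewrite addnS; apply: cf_pow.
  by apply/(quotient_commute _ _ piN); rewrite addnS; apply: cf_comm.
Qed.

(** Let h be in gamma_(m+1) and write f g = g u and f h = h v, so that u is in N_0
and, inductively, v is in N_m. Modulo N_(m+1), v is central and, by [comm_lower_central], u commutes with h and
with [g, h]; hence f fixes [g, h], and it fixes h^p since v^p vanishes. *)
Lemma endo_lower_central (f : UMagmaMorphism.type G G) :
    (forall g, N 0 (g^-1 * f g)) ->
  forall m x, lower_central p G m.+1 x -> N m (x^-1 * f x).
Proof.
move=> f0; elim=> [//|m IHm].
have [Q [pi piN]] := cf_quotient m.+1.
have SE x : N m.+1 (x^-1 * f x) <-> pi (f x) = pi x.
  rewrite piN gmulfM gmulfV; split=> [/mulg1_eq | ->]; last exact: mulVg.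
  by rewrite invgK.
apply: (@lower_central_sub G m [set x | N m.+1 (x^-1 * f x)]).
- apply/group_closed_set; split=> [|x y] /=; rewrite !SE; first by rewrite !gmulf1.
  by move=> fx fy; rewrite !gmulfF fx fy.
- move=> g h Gh /=; rewrite SE.
  have fE x : f x = x * (x^-1 * f x) by rewrite mulVKg.
  rewrite !gmulfR (fE g) (fE h) [pi (g * _)]gmulfM [pi (h * _)]gmulfM.
  set u := g^-1 * f g; set v := h^-1 * f h.
  have Nu : N 0 u by apply: f0.
  have Nv : N m v by apply: IHm.
  have cv z : commute (pi v) (pi z).
    by apply/(quotient_commute _ _ piN); apply: (cf_comm cfN).
  apply: commg_mulr; [exact: cv | exact: cv | exact: cv | |].
  - by apply/(quotient_commute _ _ piN); apply: (@comm_lower_central 0).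
  - rewrite -gmulfR; apply/(quotient_commute _ _ piN)/(cf_desc cfN).
    by apply: (@comm_lower_central 0 m.+1 _ _ Nu); apply: lower_central_comm.
- move=> h Gh /=; rewrite SE.
  have Nv : N m (h^-1 * f h) by apply: IHm.
  rewrite !gmulfXn -[f h](mulVKg h) gmulfM expgMn.
    rewrite -[X in _ * X]gmulfXn (_ : pi (_ ^+ p) = 1) ?mulg1 //.
    by apply/piN; apply: cf_pow.
  by apply/commute_sym/(quotient_commute _ _ piN); apply: cf_comm.
Qed.

End Filtration.

(** * p-almost direct products *)

Section AlmostDirect.
Variables (A B C : groupType) (iota : UMagmaMorphism.type A B)
  (lambda : UMagmaMorphism.type B C) (sigma : UMagmaMorphism.type C B).
Hypothesis splitB : split_exact iota lambda sigma setT setT setT.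
Hypothesis almost_direct : p_almost_direct p iota sigma.

Lemma iota_inj : injective iota.
Proof. by move=> a b; apply: (iota_injective splitB); rewrite inE. Qed.

Lemma sigmaK : cancel sigma lambda.
Proof. by move=> c; apply: (lambda_sigma splitB); rewrite inE. Qed.

Lemma lambda_iota a : lambda (iota a) = 1.
Proof.
have : (iota @` setT) (iota a) by exists a.
by rewrite (exact_middle splitB) => -[].
Qed.

Lemma ker_lambda b : lambda b = 1 -> exists a, iota a = b.
Proof.
move=> lb; have : ([set: B] `&` lambda @^-1` [set 1]) b by split.
by rewrite -(exact_middle splitB) => -[a _ <-]; exists a.
Qed.

Lemma conj_endo c : exists f : UMagmaMorphism.type A A,
  forall a, iota (f a) = iota a ^ sigma c.
Proof.
have /choice [f fE] a : exists b, iota b = iota a ^ sigma c.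
  by apply: ker_lambda; rewrite gmulfJ lambda_iota conj1g.
have fF : {morph f : x y / x / y}.
  by move=> x y; apply: iota_inj; rewrite gmulfF !fE gmulfF conjMg conjVg.
pose fM : UMagmaMorphism.type A A :=
  HB.pack f (isGroupMorphism.Build A A f fF).
by exists fM.
Qed.

Lemma almost_direct_conj c a b : iota b = iota a ^ sigma c ->
  lower_central p A 2 (a^-1 * b).
Proof.
move=> bE; pose X := left_coset (lower_central p A 2) a.
have Xb : conj_action iota sigma c X b.
  exists a; last exact: esym.
  exists 1; last exact: mulg1.
  exact: (set_closed1 (lower_central_closed _ _)).
have H1X : H1 p A X by exists a.
by move: Xb; rewrite (almost_direct c H1X) => -[y Gy <-]; rewrite mulKg.
Qed.

Lemma comm_conj_lower_central c n a : lower_central p A n.+1 a ->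
  exists2 a', lower_central p A n.+2 a' & iota a' = [~ iota a, sigma c].
Proof.
move=> Aa; have [f fE] := conj_endo c.
exists (a^-1 * f a); last by rewrite gmulfM gmulfV fE.
pose N k := lower_central p A k.+2.
apply: (@endo_lower_central A N _ f _ n) => //.
  exact: (central_filtration_shift (lower_central_filtration A)).
by move=> g; apply: almost_direct_conj (fE g).
Qed.

(** The commutator condition holds for elements of iota(A) by definition of the
filtration, for elements of sigma(C) by [comm_conj_lower_central], and every
element of B is a product of one of each. *)
Lemma image_filtration :
  central_filtration (fun k => iota @` lower_central p A k.+1).
Proof.
have clA k := @lower_central_closed A k.
have clN k : group_closed (mem (iota @` lower_central p A k)).
  apply/group_closed_set; split.
    by exists 1; [apply: set_closed1 | apply: gmulf1].
  move=> _ _ [x Ax <-] [y Ay <-]; exists (x / y); last exact: gmulfF.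
  exact: set_closedF.
split=> [k|k|k _ b [a Aa <-]|k _ [a Aa <-]].
- exact: clN.
- by apply: image_subset; apply: lower_central_desc.
- have lb : lambda (b / sigma (lambda b)) = 1.
    by rewrite gmulfF sigmaK mulgV.
  have [a1 a1E] := ker_lambda lb.
  rewrite -[b](mulgVK (sigma (lambda b))) -a1E.
  have Na1 : (iota @` lower_central p A k.+2) [~ iota a, iota a1].
    exists [~ a, a1]; last exact: gmulfR.
    exact: (cf_comm (lower_central_filtration A)).
  have Nconj c z : (iota @` lower_central p A k.+2) z ->
      (iota @` lower_central p A k.+2) (z ^ sigma c).
    move=> [x Ax <-].
    have -> : iota x ^ sigma c = iota x * [~ iota x, sigma c].
      by rewrite commgEl mulVKg.
    apply: (set_closedM (clN _)); first by exists x.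
    have [y Ay <-] := comm_conj_lower_central c Ax.
    by exists y => //; apply: lower_central_desc.
  set c := lambda b.
  have -> : [~ iota a, iota a1 * sigma c]
      = [~ iota a, sigma c] * [~ iota a, iota a1] ^ sigma c.
    rewrite [in RHS]commgEl -mulgA.
    by rewrite -conjMg commgEl conjgM commgEl mulVKg.
  apply: (set_closedM (clN _)); last exact: Nconj.
  by have [y Ay <-] := comm_conj_lower_central c Aa; exists y.
- by exists (a ^+ p); [apply: lower_central_pow | apply: gmulfXn].
Qed.

(** Modulo iota(gamma_n A), the retraction sigma o lambda of B fixes
gamma_n B pointwise. *)
Lemma retraction_lower_central n b : lower_central p B n.+1 b ->
  (iota @` lower_central p A n.+1) (b^-1 * sigma (lambda b)).
Proof.
apply: (endo_lower_central image_filtration (f := sigma \o lambda)) => g /=.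
have [|a <-] := @ker_lambda (g^-1 * sigma (lambda g)); last by exists a.
by rewrite gmulfM sigmaK gmulfV mulVg.
Qed.

End AlmostDirect.
End LowerCentral.

Theorem theorem4 (p : nat) (p_prime : prime p) (A B C : groupType)
    (iota : UMagmaMorphism.type A B) (lambda : UMagmaMorphism.type B C)
    (sigma : UMagmaMorphism.type C B)
    (ABC_split : split_exact iota lambda sigma setT setT setT)
    (ABC_almost_direct : p_almost_direct p iota sigma)
    (n : nat) (n_ge1 : 1 <= n) :
  split_exact iota lambda sigma
    (lower_central p A n) (lower_central p B n) (lower_central p C n).
Proof.
case: n n_ge1 => // n _.
split; try exact: lower_central_closed.
- by move=> a; apply: lower_central_morph.
- by move=> b; apply: lower_central_morph.
- by move=> c; apply: lower_central_morph.
- by move=> a b _ _; apply: (iota_inj ABC_split).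
- apply/seteqP; split=> [_ [a Aa <-] | b [Bb /= lb]].
    by split; [apply: lower_central_morph | apply: (lambda_iota ABC_split)].
  (* Here sigma (lambda b) = 1, so that b is 1 modulo iota(gamma_n A). *)
  have [a Aa] := retraction_lower_central ABC_split ABC_almost_direct Bb.
  rewrite lb gmulf1 mulg1 => aE; exists (a^-1)%g.
    exact: (set_closedV (lower_central_closed p A n.+1)).
  by rewrite gmulfV aE invgK.
- move=> c Cc; exists (sigma c); last exact: (sigmaK ABC_split).
  exact: lower_central_morph.
- by move=> c _; apply: (sigmaK ABC_split).
Qed.
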